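(* Let $K\ge 4$, $L\ge 1$, $T\ge 1$ be integers. For $1\le i,j\le K$ let $\mathbf{H}_{ij}=\mathrm{diag}[h_{ij}^{(1)},\dots,h_{ij}^{(L)}]\otimes\mathbf{I}_T\in\mathbb{R}^{TL\times TL}$, where the joint distribution of the $LK^2$ real random variables $\{h_{ij}^{(\ell)}\}_{i,j=1,\dots,K,\ \ell=1,\dots,L}$ has a density in $\mathbb{R}^{LK^2}$ (block fading with coherence period $T$). Then, with probability $1$, the maximum sum degrees of freedom achievable with vector space interference alignment strategies satisfies \[ \mathrm{DoF}\le\frac{K}{2}\left(1-\frac{1}{20\sqrt{L}}\right). \]
   Context: $\otimes$ is the Kronecker product and $\mathbf{I}_T$ is the $T\times T$ identity, so $\mathbf{H}_{ij}$ is diagonal with each $h_{ij}^{(\ell)}$ repeated $T$ consecutive times. For a matrix $\mathbf{H}$ and a subspace $V$, $\mathbf{H}V=\{\mathbf{H}\mathbf{v}:\mathbf{v}\in V\}$; sums of subspaces are spans of unions. Given the channel matrices $\{\mathbf{H}_{ij}\}$, a vector space strategy with parameter $D$ (a nonnegative integer) is a choice of subspaces $V_1,\dots,V_K\subseteq\mathbb{R}^{TL}$, each of dimension $D$ ($V_i$ is the column span of the precoding matrix of transmitter $i$, which sends $D$ symbols; the subspaces may depend on the channel matrices). The decoding condition at receiver $i$ is \[ \mathbf{H}_{ii}V_i\cap\Bigl(\sum_{j\ne i}\mathbf{H}_{ij}V_j\Bigr)=\{0\}. \] The maximum sum (total) degrees of freedom is \[ \mathrm{DoF}=\max \frac{KD}{TL},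 \] the maximum being over all $D$ and all $\{V_i\}$ with $\dim V_i=D$ that satisfy the decoding condition at every receiver $i=1,\dots,K$. *)

(* Defs.v *)
From HB Require Import structures.
From mathcomp Require Import all_boot all_order all_algebra.
From mathcomp Require Import all_classical all_reals all_analysis.
From mathcomp.real_closed Require Import mxtens.

Set Implicit Arguments.
Unset Strict Implicit.
Unset Printing Implicit Defensive.

Import Order.TTheory GRing.Theory Num.Theory.
Import numFieldNormedType.Exports.

Local Open Scope classical_set_scope.
Local Open Scope ring_scope.

Definition tcons (T : Type) (n : nat) (p : T * n.-tuple T) : n.+1.-tuple T :=
  [tuple of p.1 :: p.2].

(* The n-dimensional Lebesgue measure, built one coordinate at a time as the
   image of the product measure [lebesgue_measure \x mu] under [tcons];
   [lebesgue_tuple_box] is its characteristic property.  [n.-tuple R] carries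
   the library's product sigma-algebra, i.e. the Borel sets of R^n. *)
Section lebesgue_tuple.
Variable R : realType.

Lemma measurable_tcons n :
  measurable_fun [set: measurableTypeR R * n.-tuple R]
    (@tcons R n).
Proof. exact: measurable_cons. Qed.

Section step.
Variables (n : nat)
  (mu : {sigma_finite_measure set (n.-tuple R) -> \bar R}).

Definition lebesgue_tcons :
    set (n.+1.-tuple R) -> \bar R :=
  pushforward (@lebesgue_measure R \x mu)%E
    (@tcons R n).

Let lebesgue_tcons0 : lebesgue_tcons set0 = 0%E.
Proof. by rewrite /lebesgue_tcons /pushforward preimage_set0 measure0. Qed.

Let lebesgue_tcons_ge0 A : (0 <= lebesgue_tcons A)%E.
Proof. by rewrite /lebesgue_tcons /pushforward; exact: measure_ge0. Qed.

Let lebesgue_tcons_sigma_additive : semi_sigma_additive lebesgue_tcons.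
Proof.
move=> F mF tF mUF; rewrite /lebesgue_tcons /pushforward preimage_bigcup.
have mp A : measurable A -> measurable (@tcons R n @^-1` A).
  by move=> mA; rewrite -[X in measurable X]setTI; exact: measurable_tcons.
apply: measure_semi_sigma_additive.
- by move=> i; exact: mp.
- apply/trivIsetP => /= i j _ _ ij; rewrite -preimage_setI.
  by move/trivIsetP : tF => /(_ _ _ _ _ ij) ->//; rewrite preimage_set0.
- by rewrite -preimage_bigcup; exact: mp.
Qed.

HB.instance Definition _ := isMeasure.Build _ _ _ lebesgue_tcons
  lebesgue_tcons0 lebesgue_tcons_ge0 lebesgue_tcons_sigma_additive.

(* The library proves the product of sigma-finite measures sigma-finite, but
   canonical inference on [\x] finds an instance for pairs of subprobabilities
   instead, so the covering by rectangles is redone here. *)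
Let lebesgue_tcons_sigma_finite : sigma_finite setT lebesgue_tcons.
Proof.
have /sigma_finiteP[F [TF ndF Foo]] := sigma_finiteT (@lebesgue_measure R).
have /sigma_finiteP[G [TG ndG Goo]] := sigma_finiteT mu.
pose FG k := F k `*` G k.
have UF : setT = \bigcup_k FG k.
  rewrite -setXTT TF TG predeqE => -[x y]; split.
    move=> [/= [n1 _ Fnx] [k _ Gky]]; exists (maxn n1 k) => //; split.
    - by move: x Fnx; exact/subsetPset/ndF/leq_maxl.
    - by move: y Gky; exact/subsetPset/ndG/leq_maxr.
  by move=> [n1 _ []/= ? ?]; split; exists n1.
have mF k : measurable (FG k) /\ ((@lebesgue_measure R \x mu) (FG k) < +oo)%E.
  have [? ?] := Foo k; have [? ?] := Goo k; split; first exact: measurableX.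
  by rewrite product_measure1E// lte_mul_pinfty// ge0_fin_numE.
pose g (t : n.+1.-tuple R) := (thead t, [tuple of behead t]).
have gK : cancel (@tcons R n) g.
  move=> [x t]; rewrite /g /tcons /= theadE; congr pair.
  exact/val_inj.
have mg : measurable_fun setT g.
  apply/measurable_fun_pair => /=.
    exact: measurable_tnth.
  exact: measurable_behead.
exists (fun i => g @^-1` FG i).
  by rewrite -preimage_bigcup -UF preimage_setT.
move=> i; split.
  by rewrite -[X in measurable X]setTI; apply: mg => //; exact: (mF i).1.
rewrite /lebesgue_tcons /pushforward -comp_preimage.
rewrite (_ : g \o _ = idfun) ?preimage_id; last by apply/funext => p /=.
exact: (mF i).2.
Qed.

HB.instance Definition _ := Measure_isSigmaFinite.Build _ _ _ lebesgue_tcons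
  lebesgue_tcons_sigma_finite.

End step.

Fixpoint lebesgue_tuple (n : nat) :
    {sigma_finite_measure set (n.-tuple R) -> \bar R} :=
  match n with
  | 0%N => \d_ ([tuple] : 0.-tuple R)
  | n.+1 => lebesgue_tcons (lebesgue_tuple n)
  end.

Lemma lebesgue_tuple_box n (A : 'I_n -> set R) :
  (forall i, measurable (A i)) ->
  lebesgue_tuple n [set t | forall i, A i (tnth t i)] =
  (\prod_(i < n) lebesgue_measure (A i))%E.
Proof.
elim: n A => [|n ih] A mA /=.
  by rewrite big_ord0 diracE mem_set // => -[].
rewrite /lebesgue_tcons /pushforward.
rewrite (_ : _ @^-1` _ =
    A ord0 `*` [set t | forall i, A (lift ord0 i) (tnth t i)]).
  rewrite product_measure1E; [|exact: mA|].
    by rewrite big_ord_recl -(ih (fun i => A (lift ord0 i))) // => i; exact: mA.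
  rewrite (_ : mkset _ = \bigcap_(i in [set: 'I_n])
     ((fun t : n.-tuple R => tnth t i) @^-1` A (lift ord0 i))).
    apply: fin_bigcap_measurable => // i _.
    rewrite -[X in measurable X]setTI; exact: measurable_tnth.
  by apply/seteqP; split => t /= h i; [move=> _|]; exact: h.
apply/seteqP; split => -[x t] /= h.
  split; first by have := h ord0; rewrite /tcons tnth0.
  by move=> i; have := h (lift ord0 i); rewrite /tcons tnthS.
case: h => hx ht i; case: (unliftP ord0 i) => [j ->|->].
  by rewrite /tcons tnthS; exact: ht.
by rewrite /tcons tnth0.
Qed.

End lebesgue_tuple.

Definition has_density d (T : measurableType d) (R : realType)
    (P : probability T R) (n : nat)
    (X : {RV P >-> n.-tuple R}) : Prop :=
  exists f : n.-tuple R -> R,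
    [/\ measurable_fun setT f, forall x, 0 <= f x &
        forall A, measurable A ->
          distribution P X A = (\int[lebesgue_tuple R n]_(x in A) (f x)%:E)%E].

Section joint.
Context d (T : measurableType d) (R : realType) (P : probability T R).
Variables (I : finType) (X : I -> {RV P >-> R}).

(* The coordinates are listed in the order of [enum I]; as Lebesgue measure is
   invariant under permutation of coordinates, whether the joint law has a
   density does not depend on it. *)
Definition joint (w : T) : #|I|.-tuple R :=
  [tuple X (enum_val k) w | k < #|I|].

Let measurable_joint : measurable_fun setT joint.
Proof.
apply/measurable_fun_tnthP => k.
rewrite (_ : _ \o _ = X (enum_val k)); first exact: measurable_funPT.
by apply/funext => w /=; rewrite tnth_mktuple.
Qed.

HB.instance Definition _ := isMeasurableFun.Build _ _ _ _ joint measurable_joint.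

Definition joint_RV : {RV P >-> #|I|.-tuple R} :=
  joint : {mfun _ >-> _}.

End joint.

Section strategy.
Variables (R : realType) (K L T : nat).

(* [tensmx] puts the entry of index (l, t) at position l * T + t, so the
   diagonal repeats each [h l] T consecutive times. *)
Definition channel_mx (h : 'I_L -> R) : 'M[R]_(L * T) :=
  diag_mx (\row_l h l) *t 1%:M.

Definition mx_image (n : nat) (A : 'M[R]_n) (V : {vspace 'cV[R]_n}) :
    {vspace 'cV[R]_n} :=
  (linfun (mulmx A) @: V)%VS.

Definition vs_strategy (H : 'I_K -> 'I_K -> 'M[R]_(L * T)) (D : nat)
    (V : 'I_K -> {vspace 'cV[R]_(L * T)}) : Prop :=
  (forall i, \dim (V i) = D) /\
  (forall i, mx_image (H i i) (V i) :&:
             \sum_(j < K | j != i) mx_image (H i j) (V j) = 0)%VS.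

Definition achievable_DoF (H : 'I_K -> 'I_K -> 'M[R]_(L * T)) : set R :=
  [set (K * D)%:R / (T * L)%:R | D in
    [set D | exists V, vs_strategy H D V]].

(* The supremum is a maximum, see [DoF_max]. *)
Definition DoF (H : 'I_K -> 'I_K -> 'M[R]_(L * T)) : R :=
  sup (achievable_DoF H).

Lemma DoF_max (H : 'I_K -> 'I_K -> 'M[R]_(L * T)) :
  achievable_DoF H (DoF H) /\ ubound (achievable_DoF H) (DoF H).
Proof.
pose A := [set D | exists V, vs_strategy H D V].
have A0 : A 0%N.
  exists (fun=> 0%VS); split => [i|i]; first exact: dimv0.
  by rewrite /mx_image limg0 cap0v.
have [D AD Dmax] : exists2 D, A D & forall D', A D' -> (K * D' <= K * D)%N.
  have [->|K0] := posnP K; first by exists 0%N.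
  have exA : exists D, `[< A D >] by exists 0%N; exact/asboolP.
  have ubA D : `[< A D >] -> (D <= L * T)%N.
    move=> /asboolP[V [/(_ (Ordinal K0)) <- _]].
    by rewrite (leq_trans (dimvS (subvf _)))// dimvf /dim /= muln1.
  case: (ex_maxnP exA ubA) => D /asboolP AD Dmax; exists D => // D' AD'.
  by rewrite leq_mul2l Dmax ?orbT//; exact/asboolP.
pose v : R := (K * D)%:R / (T * L)%:R.
have Sv : achievable_DoF H v by exists D.
have ubv : ubound (achievable_DoF H) v.
  move=> _ [D' AD' <-]; rewrite ler_wpM2r ?invr_ge0 ?ler0n// ler_nat.
  exact: Dmax.
suff -> : DoF H = v by [].
apply/eqP; rewrite eq_le; apply/andP; split; first by apply: ge_sup => //; exists v.
by apply: ub_le_sup => //; exists v.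
Qed.

End strategy.

(* Main.v *)
(* Put N = LT and E = N - D.  Decodability bounds the dimension of the
   interference at every receiver by E, so, when 2D is close to N, following
   alignments around closed loops of users and receivers gives three diagonal
   matrices s_0, s_1, s_2 with dim (s_0 V + s_1 V + s_2 V) <= 3E - 2D for V the
   space of one user, while a subspace U of dimension at least 2D - E of
   (a scaling of) V also lies in the space of another user.  A nonzero X <= U
   minimising k = dim (s_0 X + s_1 X + s_2 X) / dim X <= (3E - 2D) / (2D - E)
   satisfies, by a linear version of Petridis' proof of Pluennecke's inequality,
   dim (sum of the w X, w a monomial of degree n in the s_i) <= k ^ n dim X.
   As soon as 'C(n + 2, 2) >= L, these monomials almost surely span all diagonal
   matrices (constant on blocks of length T), and decodability at one more
   receiver, where X is both signal and interference, forces k ^ n >= 2.  With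
   n ~ sqrt (2L) this bounds D away from N / 2. *)

Require Import Defs.
From mathcomp Require Import all_boot all_order all_algebra ring lra zify.
From mathcomp Require Import all_classical all_reals all_analysis.
From mathcomp Require Import measurable_realfun.
From mathcomp.real_closed Require Import mxtens.

Set Implicit Arguments.
Unset Strict Implicit.
Unset Printing Implicit Defensive.

Import Order.TTheory GRing.Theory Num.Theory.

Local Open Scope classical_set_scope.
Local Open Scope ring_scope.

(** * Growth of subspaces under commuting injective endomorphisms *)

Section Petridis.
Variables (F : fieldType) (E : vectType F).
Implicit Types (S C : seq 'End(E)) (X Y U W : {vspace E}) (c s : 'End(E)).

Definition image_sum S X : {vspace E} := (\sum_(s <- S) s @: X)%VS.

Lemma image_sum_cons s S X : image_sum (s :: S) X = (s @: X + image_sum S X)%VS.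
Proof. exact: big_cons. Qed.

Lemma image_sumS S X Y : (X <= Y)%VS -> (image_sum S X <= image_sum S Y)%VS.
Proof.
move=> XY; rewrite /image_sum; elim/big_ind2 : _ => // [U1 U2 W1 W2|s _].
  exact: addvS.
exact: limgS.
Qed.

Lemma limg_image_sum c S X : {in S, forall s, (c \o s = s \o c)%VF} ->
  (c @: image_sum S X)%VS = image_sum S (c @: X).
Proof.
move=> cS; rewrite /image_sum limg_sum big_seq [RHS]big_seq.
by apply: eq_bigr => s sS; rewrite -!limg_comp cS.
Qed.

Lemma image_sumC S C X :
  {in C, forall c, {in S, forall s, (c \o s = s \o c)%VF}} ->
  image_sum S (image_sum C X) = image_sum C (image_sum S X).
Proof.
elim: C => [|c C IH] CS.
  rewrite /image_sum !big_nil big1_seq// => s _; exact: limg0.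
rewrite !image_sum_cons -IH => [|c' c'C]; last by apply: CS; rewrite inE c'C orbT.
rewrite limg_image_sum; last by apply: CS; rewrite mem_head.
by rewrite /image_sum -big_split/=; apply: eq_bigr => s _; rewrite limgD.
Qed.

(* Petridis' proof of Pluennecke's inequality, with subspaces in place of sets. *)
Lemma petridis S C X :
  {in C, forall c, {in S, forall s, (c \o s = s \o c)%VF}} ->
  {in C, forall c, lker c == 0%VS} ->
  (forall Y, (Y <= X)%VS ->
     (\dim (image_sum S X) * \dim Y <= \dim (image_sum S Y) * \dim X)%N) ->
  (\dim X * \dim (image_sum C (image_sum S X)) <=
   \dim (image_sum S X) * \dim (image_sum C X))%N.
Proof.
move=> CS Cinj Xmin; elim: C CS Cinj => [|c C IH] CS Cinj.
  by rewrite /image_sum big_nil dimv0 muln0.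
have CS' : {in C, forall c, {in S, forall s, (c \o s = s \o c)%VF}}.
  by move=> c' h; apply: CS; rewrite inE h orbT.
have {}IH : _ := IH CS' (fun c' h => Cinj c' (@mem_behead _ (c :: C) _ h)).
have /eqP c0 := Cinj c (mem_head _ _).
have dc W : \dim (c @: W) = \dim W by rewrite limg_dim_eq// c0 capv0.
set p := \dim (image_sum S X); set q := \dim X.
(* [c @: Y] is the part of [c @: X] already in [image_sum C X], hence the dimension that adding [c]
   fails to gain there. The loss after applying [S] is at least [\dim (image_sum S Y)], which
   minimality of [X] bounds below in proportion. *)
pose Y := (X :&: c @^-1: image_sum C X)%VS.
have YX : (Y <= X)%VS by exact: capvSl.
have capY : (c @: X :&: image_sum C X <= c @: Y)%VS.
  apply/subvP => v; rewrite memv_cap => /andP[/memv_imgP[x xX ->] cx].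
  by rewrite memv_img// memv_cap xX -memv_preim.
have cY : (c @: image_sum S Y <=
    c @: image_sum S X :&: image_sum C (image_sum S X))%VS.
  rewrite subv_cap limgS ?image_sumS//= -image_sumC// limg_image_sum; last first.
    by apply: CS; rewrite mem_head.
  apply: image_sumS; apply/subvP => _ /memv_imgP[x xY ->].
  by move: xY; rewrite memv_cap -memv_preim => /andP[].
rewrite !image_sum_cons.
have /(congr1 (muln p)) := dimv_sum_cap (c @: X) (image_sum C X).
have /(congr1 (muln q)) :=
  dimv_sum_cap (c @: image_sum S X) (image_sum C (image_sum S X)).
have : (p * \dim (c @: X :&: image_sum C X) <= p * \dim Y)%N.
  by rewrite leq_mul2l -(dc Y) dimvS ?orbT.
have : (q * \dim (image_sum S Y) <= q * \dim
    (c @: image_sum S X :&: image_sum C (image_sum S X)))%N.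
  by rewrite leq_mul2l -(dc (image_sum _ Y)) dimvS ?orbT.
have := Xmin _ YX; rewrite !dc -/p -/q !mulnDr [(\dim (image_sum S Y) * q)%N]mulnC.
rewrite [(p * q)%N]mulnC; lia.
Qed.

Fixpoint words S n : seq 'End(E) :=
  if n is n'.+1 then [seq (s \o c)%VF | s <- S, c <- words S n'] else [:: \1%VF].

Lemma image_sum_words S n X :
  image_sum (words S n.+1) X = image_sum S (image_sum (words S n) X).
Proof.
rewrite /image_sum /= big_allpairs_dep /=; apply: eq_bigr => s _.
by rewrite limg_sum; apply: eq_bigr => c _; rewrite limg_comp.
Qed.

Lemma mem_words_comp S n s c :
  s \in S -> c \in words S n -> (s \o c)%VF \in words S n.+1.
Proof. by move=> sS cS; apply: allpairs_f. Qed.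

Lemma words_comm S n :
  {in S &, forall s t, (s \o t = t \o s)%VF} ->
  {in words S n, forall c, {in S, forall s, (c \o s = s \o c)%VF}}.
Proof.
move=> SS; elim: n => [|n IH] c /=.
  by rewrite inE => /eqP-> s _; rewrite comp_lfun1l comp_lfun1r.
move=> /allpairsP[[t c'] /= [tS c'S ->]] s sS.
by rewrite -comp_lfunA (IH c')// !comp_lfunA (SS t).
Qed.

Lemma words_inj S n :
  {in S, forall s, lker s == 0%VS} -> {in words S n, forall c, lker c == 0%VS}.
Proof.
move=> Sinj; elim: n => [|n IH] c /=.
  by rewrite inE => /eqP->; apply/lker0P => u v; rewrite !id_lfunE.
move=> /allpairsP[[t c'] /= [tS c'S ->]]; apply/lker0P => u v.
rewrite !comp_lfunE => /(lker0P (Sinj _ tS))/(lker0P (IH _ c'S)); exact.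
Qed.

(** Each further factor [S] costs at most the ratio [\dim (image_sum S X) / \dim X], by [petridis]
    with [C := words S n]; denominators are cleared. *)
Lemma dim_image_sum_words S n X :
  {in S &, forall s t, (s \o t = t \o s)%VF} ->
  {in S, forall s, lker s == 0%VS} ->
  (forall Y, (Y <= X)%VS ->
     (\dim (image_sum S X) * \dim Y <= \dim (image_sum S Y) * \dim X)%N) ->
  (\dim X ^ n * \dim (image_sum (words S n) X) <=
   \dim (image_sum S X) ^ n * \dim X)%N.
Proof.
move=> SS Sinj Xmin; elim: n => [|n IH].
  by rewrite /image_sum /= big_seq1 lim1g !expn0 !mul1n.
have wS := words_comm (n := n) SS.
rewrite image_sum_words image_sumC//.
rewrite expnSr -mulnA (leq_trans (n := \dim X ^ n *
  (\dim (image_sum S X) * \dim (image_sum (words S n) X))))//.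
  by rewrite leq_mul2l petridis ?orbT//; exact: words_inj.
by rewrite mulnCA expnS -mulnA leq_mul2l IH orbT.
Qed.

(** Descent on dimension: a subspace violating minimality of [U] has a strictly smaller ratio, so it
    differs from [U] and has smaller dimension. *)
Lemma exists_min_ratio S U : U != 0%VS -> exists X, [/\ (X <= U)%VS, X != 0%VS,
  forall Y, (Y <= X)%VS ->
    (\dim (image_sum S X) * \dim Y <= \dim (image_sum S Y) * \dim X)%N &
  (\dim (image_sum S X) * \dim U <= \dim (image_sum S U) * \dim X)%N].
Proof.
have [m] := ubnP (\dim U); elim: m U => // m IH U Um U0.
have [Umin|/existsNP[Y /not_implyP[YU /negP]]] := pselect (forall Y, (Y <= U)%VS ->
    (\dim (image_sum S U) * \dim Y <= \dim (image_sum S Y) * \dim U)%N).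
  by exists U.
rewrite -ltnNge => Ylt.
have Y0 : Y != 0%VS.
  by apply: contraTneq Ylt => ->; rewrite dimv0 muln0.
have dYU : (\dim Y < \dim U)%N.
  rewrite ltn_neqAle dimvS// andbT; apply: contraTneq Ylt => dYU.
  have /eqP -> : Y == U by rewrite eqEdim YU dYU leqnn.
  by rewrite ltnn.
have [|X [XY X0 Xmin XdY]] := IH Y _ Y0; first exact: leq_trans dYU Um.
exists X; split => //; first exact: subv_trans YU.
have Y_gt0 : (0 < \dim Y)%N by rewrite lt0n dimv_eq0.
rewrite -(leq_pmul2l Y_gt0) mulnCA (mulnC _ (\dim U)) mulnA.
rewrite mulnC in XdY.
nia.
Qed.

End Petridis.

(** * Diagonal channel matrices acting on subspaces *)

Section diagonal_action.
Variables (R : realType) (L T : nat).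
Implicit Types (g : 'I_L -> R) (V W : {vspace 'cV[R]_(L * T)}).

Definition act g : 'End('cV[R]_(L * T)) := linfun (mulmx (channel_mx T g)).

Lemma actE g v k j : act g v k j = g (mxtens_unindex k).1 * v k j.
Proof.
rewrite lfunE/= mxE (bigD1 k)//= big1 ?addr0 => [|i ik].
  by rewrite !mxE !eqxx mulr1.
rewrite !mxE; have [e1|] := eqVneq (mxtens_unindex k).1; last by rewrite mulr0n !mul0r.
have [e2|] := eqVneq (mxtens_unindex k).2; last by rewrite mulr0 mul0r.
case/eqP: ik; apply: (can_inj (@mxtens_unindexK L T)).
by rewrite [LHS]surjective_pairing [RHS]surjective_pairing e1 e2.
Qed.

Lemma act_comp g g' : (act g \o act g')%VF = act (fun l => g l * g' l).
Proof.
by apply/lfunP => v; apply/matrixP => k j; rewrite comp_lfunE !actE mulrA.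
Qed.

Lemma act_img g g' V : (act g @: (act g' @: V) = act (fun l => g l * g' l) @: V)%VS.
Proof. by rewrite -limg_comp act_comp. Qed.

Lemma act1 : act (fun=> 1) = \1%VF.
Proof.
by apply/lfunP => v; apply/matrixP => k j; rewrite actE id_lfunE mul1r.
Qed.

Lemma act_lker g : (forall l, g l != 0) -> lker (act g) == 0%VS.
Proof.
move=> g0; apply/lker0P => u v uv.
have := congr1 (act (fun l => (g l)^-1)) uv.
rewrite -!comp_lfunE act_comp.
rewrite (_ : (fun l => _) = fun=> 1) ?act1 ?id_lfunE//.
by apply/funext => l; rewrite mulVf.
Qed.

Lemma dim_act g V : (forall l, g l != 0) -> \dim (act g @: V) = \dim V.
Proof. by move=> g0; rewrite limg_dim_eq// (eqP (act_lker g0)) capv0. Qed.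

Lemma act_lincomb (I : finType) (m : I -> 'I_L -> R) (c : I -> R) V W :
  (forall i, act (m i) @: V <= W)%VS ->
  (act (fun l => \sum_i c i * m i l)%R @: V <= W)%VS.
Proof.
move=> mW; apply/subvP => _ /memv_imgP[v vV ->].
rewrite (_ : act _ v = \sum_i c i *: act (m i) v).
  by apply: memv_suml => i _; rewrite memvZ// (subvP (mW i))// memv_img.
apply/matrixP => k j; rewrite actE summxE mulr_suml; apply: eq_bigr => i _.
by rewrite mxE actE mulrA.
Qed.

Lemma mem_words_act n (s0 s1 s2 : 'I_L -> R) a b c : (a + b + c = n)%N ->
  act (fun l => s0 l ^+ a * s1 l ^+ b * s2 l ^+ c) \in
    words [:: act s0; act s1; act s2] n.
Proof.
elim: n a b c => [|n IH] a b c.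
  case: a b c => [|?] [|?] [|?]//= _.
  rewrite inE -act1; apply/eqP; congr act; apply/funext => l.
  by rewrite !expr0 !mulr1.
have step s f : act s \in [:: act s0; act s1; act s2] ->
    act f \in words [:: act s0; act s1; act s2] n ->
    act (fun l => s l * f l) \in words [:: act s0; act s1; act s2] n.+1.
  by rewrite -act_comp; exact: mem_words_comp.
have eq_act f f' : f =1 f' -> act f \in words [:: act s0; act s1; act s2] n.+1 ->
    act f' \in words [:: act s0; act s1; act s2] n.+1 by move=> /funext ->.
case: a => [|a].
  case: b => [|b].
    case: c => [|c] // /succn_inj abc.
    apply: eq_act (step s2 _ _ (IH 0%N 0%N c abc)) => [l|].
      by rewrite !expr0 !mul1r exprS.
    by rewrite !inE eqxx !orbT.
  move=> /succn_inj abc.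
  apply: eq_act (step s1 _ _ (IH 0%N b c abc)) => [l|].
    by rewrite !expr0 !mul1r exprS mulrA.
  by rewrite !inE eqxx !orbT.
move=> /succn_inj abc.
apply: eq_act (step s0 _ _ (IH a b c abc)) => [l|].
  by rewrite [in RHS]exprS !mulrA.
by rewrite !inE eqxx.
Qed.

(** An invertible matrix makes the rows [m k] a basis of the functions on ['I_L], so [act g] is a
    linear combination of words. *)
Lemma act_words S n g V (m : 'I_L -> 'I_L -> R) :
  (forall k, act (m k) \in words S n) -> \det (\matrix_(k, l) m k l) != 0 ->
  (act g @: V <= image_sum (words S n) V)%VS.
Proof.
move=> mS; set M := \matrix_(k, l) m k l => M0.
have Mu : M \in unitmx by rewrite unitmxE unitfE.
pose c := (\row_l g l) *m invmx M.
have -> : act g = act (fun l => \sum_k c 0 k * m k l).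
  congr act; apply/funext => l.
  have := congr1 (fun A : 'rV_L => A 0 l) (mulmxKV Mu (\row_l g l)).
  by rewrite !mxE => <-; apply: eq_bigr => k _; rewrite /c !mxE.
apply: act_lincomb => k; rewrite /image_sum.
by rewrite (big_rem (act (m k)))//= addvSl.
Qed.

End diagonal_action.

(** * Dimension counts for interference alignment *)

Lemma dimv_glue (F : fieldType) (E : vectType F) (A B C : {vspace E}) :
  (C <= A)%VS -> (C <= B)%VS -> (\dim (A + B) + \dim C <= \dim A + \dim B)%N.
Proof.
by move=> CA CB; rewrite -[leqRHS]dimv_sum_cap leq_add2l dimvS// subv_cap CA.
Qed.

Lemma limg_disjoint (F : fieldType) (E : vectType F) (f : 'End(E)) (A B : {vspace E}) :
  lker f == 0%VS -> (A :&: B = 0)%VS -> (f @: A :&: f @: B = 0)%VS.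
Proof.
move=> /lker0P f0 AB; apply/eqP; rewrite -subv0; apply/subvP => v.
rewrite memv_cap => /andP[/memv_imgP[a aA ->] /memv_imgP[b bB /f0 ab]].
by rewrite -(limg0 f) memv_img// -AB memv_cap aA ab.
Qed.

Section alignment.
Variables (R : realType) (K L T : nat).
Variables (i0 i1 i2 i3 : 'I_K).

(* Up to the common invertible factor [s0], the maps [s1] and [s2] follow the
   approximate alignments 0 -> 3 -> 0 through receivers 2, 1 and 0 -> 2 -> 0
   through receivers 3, 1; clearing denominators keeps them polynomial. *)
Definition loop0 (h : 'I_K -> 'I_K -> 'I_L -> R) l :=
  h i1 i0 l * (h i2 i3 l * h i3 i2 l).
Definition loop1 (h : 'I_K -> 'I_K -> 'I_L -> R) l :=
  h i2 i0 l * (h i1 i3 l * h i3 i2 l).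
Definition loop2 (h : 'I_K -> 'I_K -> 'I_L -> R) l :=
  h i3 i0 l * (h i1 i2 l * h i2 i3 l).

Definition loop_monomial h n a b l :=
  loop0 h l ^+ (n - (a + b)) * loop1 h l ^+ a * loop2 h l ^+ b.

(** With [N = L * T] and [E = N - D], the bases are [2D - E = 3D - N] and [3E - 2D = 3N - 5D], so
    this is [2 <= k ^ n] with denominators cleared. *)
Lemma alignment_bound (h : 'I_K -> 'I_K -> 'I_L -> R) n (a b : 'I_L -> nat)
    D (V : 'I_K -> {vspace 'cV[R]_(L * T)}) :
  uniq [:: i0; i1; i2; i3] ->
  (forall i j l, h i j l != 0) ->
  (forall k, a k + b k <= n)%N ->
  \det (\matrix_(k, l) loop_monomial h n (a k) (b k) l) != 0 ->
  vs_strategy (fun i j => channel_mx T (h i j)) D V ->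
  (L * T < 3 * D)%N ->
  (2 * (3 * D - L * T) ^ n <= (3 * (L * T) - 5 * D) ^ n)%N.
Proof.
rewrite /= !inE !negb_or => /and4P[/and3P[i01 i02 i03] /andP[i12 i13] i23 _].
move=> h0 abn det0 [dimV decV] D3.
set N := (L * T)%N.
(* [E i] is the interference space at receiver [i]. *)
pose E i := (\sum_(j < K | j != i) act T (h i j) @: V j)%VS.
have dE i : (\dim (E i) + D <= N)%N.
  rewrite addnC -(dimV i) -(dim_act (V i) (h0 i i)) -dimv_disjoint_sum; last exact: decV.
  by rewrite (leq_trans (dimvS (subvf _)))// dimvf /dim /= muln1.
have subE : forall i j, j != i -> (act T (h i j) @: V j <= E i)%VS.
  by move=> i j ji; rewrite (sumv_sup j).
pose S := [:: act T (loop0 h); act T (loop1 h); act T (loop2 h)].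
have SS : {in S &, forall s t, (s \o t = t \o s)%VF}.
  have SP s : s \in S -> exists g, s = act T g.
    by rewrite !inE => /or3P[] /eqP->; eexists.
  move=> _ _ /SP[g ->] /SP[g' ->]; rewrite !act_comp; congr act.
  by apply/funext => l; rewrite mulrC.
have Sinj : {in S, forall s, lker s == 0%VS}.
  by move=> s; rewrite !inE => /or3P[] /eqP->; apply: act_lker => l; rewrite !mulf_neq0.
have dSV : (\dim (image_sum S (V i0)) + 5 * D <= 3 * N)%N.
  pose g1 l := h i2 i3 l * h i3 i2 l; pose g2 l := h i1 i3 l * h i3 i2 l.
  pose g3 l := h i1 i2 l * h i2 i3 l.
  pose F1 := (act T g1 @: E i1)%VS; pose F2 := (act T g2 @: E i2)%VS.
  pose F3 := (act T g3 @: E i3)%VS.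
  have subF g i j : j != i ->
      (act T (fun l => h i j l * g l) @: V j <= act T g @: E i)%VS.
    move=> ji; under eq_fun do rewrite mulrC.
    by rewrite -act_img limgS// subE.
  have SV : (image_sum S (V i0) <= F1 + F2 + F3)%VS.
    rewrite /image_sum !big_cons big_nil addv0 addvA.
    by rewrite !addvS// subF.
  (* The scalings [g1], [g2], [g3] make F1, F2 share an image of [V i3], and F1,
     F3 an image of [V i2]; each gluing saves D dimensions. *)
  pose G2 := (act T (fun l => h i2 i3 l * g2 l) @: V i3)%VS.
  pose G3 := (act T (fun l => h i3 i2 l * g3 l) @: V i2)%VS.
  have G21 : (G2 <= F1)%VS.
    rewrite /G2 (_ : (fun l => _) = (fun l => h i1 i3 l * g1 l)); last first.
      by apply/funext => l; rewrite /g1 /g2 mulrCA.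
    by apply: subF; rewrite eq_sym.
  have G31 : (G3 <= F1)%VS.
    rewrite /G3 (_ : (fun l => _) = (fun l => h i1 i2 l * g1 l)); last first.
      by apply/funext => l; rewrite /g1 /g3 mulrCA [h i3 i2 l * _]mulrC.
    by apply: subF; rewrite eq_sym.
  have G22 : (G2 <= F2)%VS by apply: subF; rewrite eq_sym.
  have G33 : (G3 <= F3)%VS by apply: subF.
  have arith s x y e1 e2 e3 : (s <= x -> x + D <= y + e3 -> y + D <= e1 + e2 ->
      e1 + D <= N -> e2 + D <= N -> e3 + D <= N -> s + 5 * D <= 3 * N)%N.
    by clear; lia.
  have F123 := dimv_glue (subv_trans G31 (addvSl _ F2)) G33.
  have F12 := dimv_glue G21 G22.
  rewrite !dim_act ?dimV in F12 F123; try by move=> l; rewrite !mulf_neq0.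
  exact: arith (dimvS SV) F123 F12 (dE i1) (dE i2) (dE i3).
(* [W] and [W2] both lie in [E i1], of dimension at most [N - D], so they overlap in dimension at
   least [2D - (N - D)]. *)
pose W := (act T (h i1 i0) @: V i0)%VS; pose W2 := (act T (h i1 i2) @: V i2)%VS.
pose U := (W :&: W2)%VS.
have dU : (3 * D <= \dim U + N)%N.
  have arith s u w w2 e : (s <= e -> s + u = w + w2 -> w = D -> w2 = D ->
      e + D <= N -> 3 * D <= u + N)%N.
    by clear; lia.
  have WW : (W + W2 <= E i1)%VS by rewrite subv_add !subE// eq_sym.
  by apply: arith (dimvS WW) (dimv_sum_cap W W2) _ _ (dE i1); rewrite dim_act.
have dSU : (\dim (image_sum S U) + 5 * D <= 3 * N)%N.
  apply: leq_trans dSV; rewrite leq_add2r.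
  apply: (leq_trans (dimvS (image_sumS S (capvSl W W2)))).
  rewrite -limg_image_sum ?dim_act// => s.
  by rewrite !inE => /or3P[] /eqP->; rewrite !act_comp; congr act;
    apply/funext => l; rewrite mulrC.
have U0 : U != 0%VS.
  apply: contraTneq dU => ->; rewrite dimv0 add0n -ltnNge.
  exact: D3.
have [X [XU X0 Xmin XdU]] := exists_min_ratio S U0.
have words_X := dim_image_sum_words n SS Sinj Xmin.
have actX g : (act T g @: X <= image_sum (words S n) X)%VS.
  apply: act_words det0 => k; apply: mem_words_act.
  by rewrite -addnA subnK.
(* Up to the common factor [g], one multiple of [X] is desired signal at receiver [i0] and another
   is interference from user [i2]. Decodability makes them independent, and [actX] puts both in the
   span of the words. *)
have XX : (2 * \dim X <= \dim (image_sum (words S n) X))%N.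
  pose g l := h i1 i0 l * h i1 i2 l.
  pose A := (act T (fun l => h i0 i0 l * h i1 i2 l) @: X)%VS.
  pose B := (act T (fun l => h i0 i2 l * h i1 i0 l) @: X)%VS.
  have Ag : (A <= act T g @: (act T (h i0 i0) @: V i0))%VS.
    apply: (subv_trans (limgS _ (subv_trans XU (capvSl _ _)))).
    rewrite /W !act_img (_ : (fun l => _) = (fun l => g l * h i0 i0 l)) ?subvv//.
    by apply/funext => l; rewrite /g mulrC mulrA mulrAC -mulrA [_ * h i0 i0 l]mulrC mulrA.
  have Bg : (B <= act T g @: (act T (h i0 i2) @: V i2))%VS.
    apply: (subv_trans (limgS _ (subv_trans XU (capvSr _ _)))).
    rewrite /W2 !act_img (_ : (fun l => _) = (fun l => g l * h i0 i2 l)) ?subvv//.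
    by apply/funext => l; rewrite /g -mulrA mulrC.
  have AB : (A :&: B = 0)%VS.
    apply/eqP; rewrite -subv0; apply: (subv_trans (capvS Ag Bg)).
    rewrite limg_disjoint//; first by apply: act_lker => l; rewrite mulf_neq0.
    apply/eqP; rewrite -subv0 -(decV i0); apply: capvS; first exact: subvv.
    by apply: subE; rewrite eq_sym.
  have /dimvS : (A + B <= image_sum (words S n) X)%VS by rewrite subv_add !actX.
  rewrite dimv_disjoint_sum// /A /B !dim_act ?mul2n ?addnn// => l;
    by rewrite mulf_neq0.
have X_gt0 : (0 < \dim X)%N by rewrite lt0n dimv_eq0.
have XdU' : (\dim (image_sum S X) * (3 * D - N) <= (3 * N - 5 * D) * \dim X)%N.
  apply: (@leq_trans (\dim (image_sum S X) * \dim U)).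
    by rewrite leq_mul2l leq_subLR addnC dU orbT.
  apply: (leq_trans XdU); rewrite leq_mul2r leq_subRL.
    by rewrite addnC dSU orbT.
  by rewrite (leq_trans _ dSU) ?leq_addl.
have {}XX : (2 * \dim X ^ n <= \dim (image_sum S X) ^ n)%N.
  rewrite -(leq_pmul2r X_gt0); apply: leq_trans words_X.
  by rewrite mulnAC mulnC leq_mul2l XX orbT.
rewrite -(@leq_pmul2r (\dim X ^ n)) ?expn_gt0 ?X_gt0// -expnMn.
apply: (@leq_trans ((\dim (image_sum S X) * (3 * D - N)) ^ n)).
  by rewrite expnMn mulnAC leq_mul2r XX orbT.
by case: (n) => // n'; rewrite leq_exp2r.
Qed.

End alignment.

(** * Numerical bounds on the degrees of freedom *)

(** Take the least such [n]: if [n > 0], then ['C(n + 1, 2) < L], which keeps [n] below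
    [sqrt (2 L)]. *)
Lemma exists_binomial_bracket L : (0 < L)%N ->
  exists2 n, (L <= 'C(n.+2, 2))%N & n = 0%N \/ (n ^ 2 + n + 2 <= 2 * L)%N.
Proof.
move=> L0.
have exn : exists n, (L <= 'C(n.+2, 2))%N.
  exists L; elim: (L) => // l IH; by rewrite binS bin1; lia.
case: (ex_minnP exn) => -[|n] Ln nmin; first by exists 0%N => //; left.
exists n.+1 => //; right.
have : ('C(n.+2, 2) < L)%N by rewrite ltnNge; apply/negP => /nmin; rewrite ltnn.
rewrite bin2 /= => h.
(* [bin2] uses the truncated half; the product of consecutive integers is even, so nothing is
   lost. *)
have := odd_double_half (n.+2 * n.+1); rewrite oddM /= andbC.
have -> : odd n.+1 && ~~ ~~ odd n = false by rewrite /=; case: (odd n).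
rewrite -!mul2n; lia.
Qed.

(** With [s = sqrt L], the quotient [(20 s + 5) / (20 s - 3)] is the value of [(3N - 5D) / (3D - N)]
    at the threshold [D / N = (1 - 1 / (20 s)) / 2]. *)
Lemma rate_bound (R : realType) (s : R) n : 1 <= s ->
  n = 0%N \/ (n ^ 2 + n + 2)%:R <= 2 * s ^+ 2 ->
  (20 * s + 5) ^+ n < 2 * (20 * s - 3) ^+ n.
Proof.
move=> s1 [->|ns]; first by rewrite !expr0; lra.
have c0 : 0 < 20 * s - 3 by lra.
pose x := 8 / (20 * s - 3).
have x0 : 0 <= x by rewrite divr_ge0//; lra.
have sx : 20 * s + 5 = (20 * s - 3) * (1 + x).
  by rewrite mulrDr mulr1 mulrCA divff ?gt_eqF//; lra.
rewrite sx exprMn mulrC ltr_pM2r ?exprn_gt0//.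
(* The constant is chosen so that [(1 - 0.585 / 2) ^ 2 > 1 / 2]; clearing the denominator gives
   [8 n + 1.755 <= 11.7 s]. *)
have xn : x * n%:R <= 585 / 1000.
  rewrite mulrAC ler_pdivrMr//.
  have : (8 * n%:R + 1755/1000) ^+ 2 <= (117/10 * s) ^+ 2.
    have : (n%:R : R) ^+ 2 + n%:R + 2 <= 2 * s ^+ 2.
      by move: ns; rewrite !natrD natrX.
    have := ler0n R n; move: (n%:R) => m m0 ms.
    rewrite !exprMn; nra.
  rewrite ler_sqr ?nnegrE; [lra| |lra].
  by have := ler0n R n; lra.
(* [expR (- y) >= 1 - y] at [y = x n / 2] gives [expR (x n) <= (1 - x n / 2) ^- 2]. *)
have e1 : (1 + x) ^+ n <= expR (x * n%:R).
  rewrite mulrC expRM_natl.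
  apply: lerXn2r; rewrite ?nnegrE ?expR_ge0 ?expR_ge1Dx//; lra.
apply: (le_lt_trans e1).
have := expR_ge1Dx (- (x * n%:R / 2)).
have : expR (x * n%:R) * (expR (- (x * n%:R / 2)) ^+ 2) = 1.
  rewrite -expRM_natl -expRD -[RHS](@expR0 R); congr expR.
  by field.
have := expR_gt0 (x * n%:R).
move: (expR (x * n%:R)) => e; move: (expR (- (x * n%:R / 2))) => f e0 ef fx.
have f0 : 707 / 1000 <= f by lra.
nra.
Qed.

(** Beyond the threshold [3D - N] only grows and the truncated [3N - 5D] only shrinks, so [bound]
    would contradict [rate_bound]. *)
Lemma rate_of_bound (R : realType) (N D L n : nat) : (0 < L)%N -> (0 < N)%N ->
  n = 0%N \/ (n ^ 2 + n + 2 <= 2 * L)%N ->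
  ((N < 3 * D)%N -> (2 * (3 * D - N) ^ n <= (3 * N - 5 * D) ^ n)%N) ->
  (D%:R / N%:R : R) <= 1 / 2 * (1 - 1 / (20 * Num.sqrt L%:R)).
Proof.
move=> L0 N0 nL bound; set s := Num.sqrt _.
have s1 : 1 <= s by rewrite -sqrtr1 ler_wsqrtr// ler1n.
have sL : s ^+ 2 = L%:R by rewrite sqr_sqrtr.
have s0 : 0 < s by lra.
have NR : 0 < N%:R :> R by rewrite ltr0n.
rewrite leNgt; apply/negP => lt.
have DN : N%:R * (20 * s - 1) < 40 * s * D%:R.
  move: lt; rewrite ltr_pdivlMr//.
  rewrite (_ : 1 / 2 * (1 - 1 / (20 * s)) * N%:R = N%:R * (20 * s - 1) / (40 * s)).
    by rewrite ltr_pdivrMr ?mulr_gt0// [D%:R * _]mulrC.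
  by field; rewrite gt_eqF.
have ND : (N < 3 * D)%N.
  by rewrite -(ltr_nat R) natrM; nra.
have := bound ND; rewrite -(ler_nat R) natrM !natrX natrB ?(ltnW ND)// natrM.
have rate : (20 * s + 5) ^+ n < 2 * (20 * s - 3) ^+ n.
  apply: rate_bound => //; case: nL => [->|nL]; [by left|right].
  by rewrite sL -natrM ler_nat.
apply/negP; rewrite -ltNge.
have u_le : (N%:R * (20 * s - 3)) ^+ n <= (40 * s * (3 * D%:R - N%:R)) ^+ n.
  by apply: lerXn2r; rewrite ?nnegrE; nra.
have w_le : (40 * s * (3 * N - 5 * D)%:R) ^+ n <= (N%:R * (20 * s + 5)) ^+ n.
  apply: lerXn2r; rewrite ?nnegrE; [by rewrite !mulr_ge0// ltW|nra|].
  have [h|h] := leqP (5 * D) (3 * N); first by rewrite natrB// !natrM; nra.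
  by rewrite (eqP (ltnW h : _ == 0)%N) mulr0; nra.
have c0 : 0 < (40 * s) ^+ n by rewrite exprn_gt0// mulr_gt0.
rewrite -(ltr_pM2l c0) mulrCA -!exprMn.
apply: (le_lt_trans w_le); apply: (lt_le_trans _ (ler_wpM2l _ u_le)) => //.
by rewrite !exprMn mulrCA ltr_pM2l// exprn_gt0.
Qed.

(** * Zero sets of polynomial functions and Lebesgue measure *)

Section polyfun.
Variables (R : realType) (n : nat).
Implicit Types f g : n.-tuple R -> R.

(* A measurable function whose restriction to every polynomial curve is a
   polynomial: a substitute for multivariate polynomial functions that is
   immediately closed under the ring operations. *)
Definition polyfun f : Prop := measurable_fun setT f /\
  forall q : 'I_n -> {poly R}, exists p : {poly R},
    forall x, f [tuple (q i).[x] | i < n] = p.[x].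

Lemma polyfun_cst c : polyfun (fun=> c).
Proof.
split; first exact: measurable_cst.
by move=> q; exists c%:P => x; rewrite hornerC.
Qed.

Lemma polyfun_tnth i : polyfun (fun t => tnth t i).
Proof.
split; first exact: measurable_tnth.
by move=> q; exists (q i) => x; rewrite tnth_mktuple.
Qed.

Lemma polyfunD f g : polyfun f -> polyfun g -> polyfun (fun t => f t + g t).
Proof.
move=> [mf pf] [mg pg]; split; first exact: (measurable_funD mf mg).
move=> q; have [a fa] := pf q; have [b gb] := pg q.
by exists (a + b) => x; rewrite hornerD fa gb.
Qed.

Lemma polyfunM f g : polyfun f -> polyfun g -> polyfun (fun t => f t * g t).
Proof.
move=> [mf pf] [mg pg]; split; first exact: (measurable_funM mf mg).
move=> q; have [a fa] := pf q; have [b gb] := pg q.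
by exists (a * b) => x; rewrite hornerM fa gb.
Qed.

Lemma polyfun_sum (I : Type) (r : seq I) (P : pred I) (F : I -> n.-tuple R -> R) :
  (forall i, polyfun (F i)) -> polyfun (fun t => \sum_(i <- r | P i) F i t).
Proof.
move=> pF; elim: r => [|i r IH].
  by under eq_fun do rewrite big_nil; exact: polyfun_cst.
under eq_fun do rewrite big_cons; case: (P i) => //.
exact: polyfunD.
Qed.

Lemma polyfun_prod (I : Type) (r : seq I) (P : pred I) (F : I -> n.-tuple R -> R) :
  (forall i, polyfun (F i)) -> polyfun (fun t => \prod_(i <- r | P i) F i t).
Proof.
move=> pF; elim: r => [|i r IH].
  by under eq_fun do rewrite big_nil; exact: polyfun_cst.
under eq_fun do rewrite big_cons; case: (P i) => //.
exact: polyfunM.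
Qed.

Lemma polyfunX f k : polyfun f -> polyfun (fun t => f t ^+ k).
Proof.
move=> pf; elim: k => [|k IH]; first exact: polyfun_cst.
by under eq_fun do rewrite exprS; exact: polyfunM.
Qed.

Lemma polyfun_det m (A : n.-tuple R -> 'M[R]_m) :
  (forall i j, polyfun (fun t => A t i j)) -> polyfun (fun t => \det (A t)).
Proof.
move=> pA; apply: polyfun_sum => s; apply: polyfunM; first exact: polyfun_cst.
exact: polyfun_prod.
Qed.

End polyfun.

Lemma root_set_null (R : realType) (p : {poly R}) : p != 0 ->
  measurable [set x | p.[x] = 0] /\ lebesgue_measure [set x | p.[x] = 0] = 0%E.
Proof.
move=> p0.
have cf : countable [set x | p.[x] = 0].
  apply: finite_set_countable; apply: contrapT.
  move=> /(infinite_set_fset (size p))[B Bp]; apply/negP; rewrite -ltnNge.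
  apply: max_poly_roots => //; last exact: finmap.fset_uniq.
  by apply/allP => x xB; exact/rootP/Bp.
split; last exact: countable_lebesgue_measure0.
exact: countable_measurable.
Qed.

(** Fubini and induction: along the first coordinate through [t0], [f] is a nonzero polynomial, so
    for all but finitely many [x] the slice at [x] is nonzero at the tail of [t0] and has a null
    zero set. *)
Lemma polyfun_null (R : realType) n (f : n.-tuple R -> R) (t0 : n.-tuple R) :
  polyfun f -> f t0 != 0 -> lebesgue_tuple R n [set t | f t = 0] = 0%E.
Proof.
elim: n f t0 => [|n IH] f t0 [mf pf] ft0.
  rewrite /= diracE (_ : _ \in _ = false)//; apply/negbTE/negP => /set_mem/=.
  move=> f0; case/eqP: ft0; rewrite -f0; congr f; apply: val_inj => /=.
  by case: t0 => -[].
pose Z := [set t | f t = 0].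
have mtc : measurable_fun setT (@tcons R n) := @measurable_tcons R n.
have mZ : measurable Z.
  rewrite (_ : Z = setT `&` f @^-1` [set 0]); last by rewrite setTI.
  exact: mf.
have mZ' : measurable (@tcons R n @^-1` Z) by rewrite -[X in measurable X]setTI; exact: mtc.
have [p pE] := pf (fun i => if i == ord0 then 'X else (tnth t0 i)%:P).
have fcons x : f (tcons (x, [tuple tnth t0 (lift ord0 i) | i < n])) = p.[x].
  rewrite -pE; congr f; apply: eq_from_tnth => i; rewrite tnth_mktuple /tcons.
  case: (unliftP ord0 i) => [j ->|->]; last by rewrite tnth0 eqxx hornerX.
  by rewrite tnthS tnth_mktuple /= hornerC.
have p0 : p != 0.
  apply: contraNneq ft0 => p0; have := fcons (thead t0); rewrite p0 horner0 => <-.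
  apply/eqP; congr f; apply: eq_from_tnth => i; rewrite /tcons.
  case: (unliftP ord0 i) => [j ->|->]; last by rewrite tnth0.
  by rewrite tnthS tnth_mktuple.
have [mN N0] := root_set_null p0.
rewrite /= /lebesgue_tcons /pushforward /product_measure1.
apply: (etrans (ge0_negligible_integral (mu := @lebesgue_measure R)
  mN measurableT _ _ N0)) => //.
  exact: measurable_fun_xsection.
apply: integral0_eq => x [_ /= px0].
rewrite (_ : xsection _ _ = [set t | f (tcons (x, t)) = 0]); last first.
  by apply/seteqP; split=> t; rewrite /xsection /= inE.
apply: (IH _ [tuple tnth t0 (lift ord0 i) | i < n]); last by apply/eqP; rewrite fcons.
split.
  apply: (measurableT_comp mf); apply: (measurableT_comp mtc).
  exact: pair1_measurable.
move=> q.
(* A curve in the slice is a curve in the whole space with constant first coordinate. *)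
have [r rE] := pf (fun i => if unlift ord0 i is Some j then q j else x%:P).
exists r => y; rewrite -rE; congr f; apply: eq_from_tnth => i.
rewrite tnth_mktuple /tcons; case: (unliftP ord0 i) => [j ->|->].
  by rewrite tnthS tnth_mktuple.
by rewrite tnth0 hornerC.
Qed.

Lemma has_density_ae d (T : measurableType d) (R : realType) (P : probability T R)
    n (X : {RV P >-> n.-tuple R}) (f : n.-tuple R -> R) t0 :
  has_density X -> polyfun f -> f t0 != 0 -> {ae P, forall w, f (X w) != 0}.
Proof.
move=> [g [mg g0 gE]] pf ft0.
pose Z := [set t | f t = 0].
have mZ : measurable Z.
  rewrite (_ : Z = setT `&` f @^-1` [set 0]); last by rewrite setTI.
  exact: pf.1.
exists (X @^-1` Z); split.
- exact: measurable_funPTI.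
- rewrite -[LHS]/(distribution P X Z) gE//.
  apply: null_set_integral => //; last exact: (polyfun_null pf ft0).
  apply/measurable_EFinP; exact: measurable_funS mg.
- by move=> w /= /negP; rewrite negbK => /eqP.
Qed.

(** * Generic linear independence of the loop monomials *)

(** There are ['C(n + 2, 2)] pairs with [a + b <= n], and [a + n.+1 * b] has [a] as its remainder
    modulo [n.+1], so it determines the pair. *)
Lemma exists_exponents n L : (L <= 'C(n.+2, 2))%N ->
  exists a b : 'I_L -> nat,
    (forall k, a k + b k <= n)%N /\ injective (fun k => a k + n.+1 * b k)%N.
Proof.
move=> Ln.
have [s [s_n us ss]] : exists s : seq (nat * nat),
    [/\ {in s, forall p, (p.1 + p.2 <= n)%N}, uniq s & size s = 'C(n.+2, 2)].
  elim: n {L Ln} => [|n [s [s_n us ss]]].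
    by exists [:: (0, 0)%N]; split => // p; rewrite inE => /eqP->.
  (* The new pairs are the [n.+2] points of the diagonal [a + b = n.+1]. *)
  exists ([seq (n.+1 - j, j)%N | j <- iota 0 n.+2] ++ s); split.
  - move=> p; rewrite mem_cat => /orP[/mapP[j]|/s_n/leqW//].
    by rewrite mem_iota => jn ->/=; rewrite subnK.
  - rewrite cat_uniq us andbT map_inj_uniq ?iota_uniq ?andTb; last by move=> ? ? [].
    apply/hasPn => p /s_n pn; apply/negP => /mapP[j].
    by rewrite mem_iota add0n => jn pE; move: pn; rewrite pE /= subnK ?ltnn.
  - by rewrite size_cat size_map size_iota ss [in RHS]binS bin1 addnC.
have sL (k : 'I_L) : (k < size s)%N by rewrite ss (leq_trans _ Ln).
exists (fun k => (nth (0, 0)%N s k).1), (fun k => (nth (0, 0)%N s k).2).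
have le_n k := s_n _ (mem_nth (0, 0)%N (sL k)).
split=> // k k' /=.
have := le_n k; have := le_n k'.
case E: (nth _ s k) => [a b]; case E': (nth _ s k') => [a' b'] /= ab' ab e.
have bb' : b = b' by nia.
have aa' : a = a' by lia.
by apply/val_inj/eqP; rewrite -(nth_uniq (0, 0)%N (sL k) (sL k') us) E E' aa' bb'.
Qed.

Section generic.
Variables (R : realType) (K L : nat) (i0 i1 i2 i3 : 'I_K).
Variables (n : nat) (a b : 'I_L -> nat).

Local Notation coord := ('I_K * 'I_K * 'I_L)%type.

Definition channel_of (t : #|{: coord}|.-tuple R) i j l : R :=
  tnth t (enum_rank (i, j, l)).

(** A single polynomial whose nonvanishing yields both conditions on the channel in
    [alignment_bound]. *)
Definition genericity (h : 'I_K -> 'I_K -> 'I_L -> R) : R :=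
  (\prod_(x : coord) h x.1.1 x.1.2 x.2) *
  \det (\matrix_(k, l) loop_monomial i0 i1 i2 i3 h n (a k) (b k) l).

Lemma polyfun_genericity : polyfun (fun t => genericity (channel_of t)).
Proof.
have pc i j l : polyfun (fun t => channel_of t i j l) by exact: polyfun_tnth.
apply: polyfunM; first exact: polyfun_prod.
apply: polyfun_det => k l; under eq_fun do rewrite mxE.
rewrite /loop_monomial /loop0 /loop1 /loop2.
by apply: polyfunM; [apply: polyfunM|]; apply: polyfunX;
  apply: polyfunM => //; apply: polyfunM.
Qed.

(* At [loop0 = 1], [loop1 l = 2 ^ l], [loop2 l = 2 ^ (n.+1 * l)] the matrix of
   monomials is a Vandermonde matrix with nodes [2 ^ (a k + n.+1 * b k)]. *)
Lemma genericity_neq0 : uniq [:: i0; i1; i2; i3] ->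
  injective (fun k => a k + n.+1 * b k)%N ->
  exists t, genericity (channel_of t) != 0.
Proof.
rewrite /= !inE !negb_or => /and4P[/and3P[i01 i02 i03] /andP[i12 i13] i23 _] inj_e.
(* Each loop contains exactly one coefficient of user [i0], at receiver [i1], [i2] or [i3]
   respectively; these set the three values while all other factors are 1. *)
pose h i j (l : 'I_L) : R := if j != i0 then 1 else
  if i == i2 then 2 ^+ l else if i == i3 then (2 ^+ l) ^+ n.+1 else 1.
exists [tuple h (enum_val x).1.1 (enum_val x).1.2 (enum_val x).2 | x < #|{: coord}|].
rewrite (_ : channel_of _ = h); last first.
  by apply/funext => i; apply/funext => j; apply/funext => l;
    rewrite /channel_of tnth_mktuple enum_rankK.
have l0 l : loop0 i0 i1 i2 i3 h l = 1.
  by rewrite /loop0 /h eqxx (negbTE i12) (negbTE i13) ![_ == i0]eq_sym i03 i02 !mulr1.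
have l1 l : loop1 i0 i1 i2 i3 h l = 2 ^+ l.
  by rewrite /loop1 /h !eqxx ![_ == i0]eq_sym i03 i02 !mulr1.
have l2 l : loop2 i0 i1 i2 i3 h l = (2 ^+ l) ^+ n.+1.
  rewrite /loop2 /h !eqxx ![_ == i0]eq_sym [i3 == i2]eq_sym (negbTE i23).
  by rewrite i03 i02 !mulr1.
have two0 : 2 != 0 :> R by rewrite pnatr_eq0.
rewrite mulf_neq0//.
  apply/prodf_neq0 => -[[i j] l] _ /=; rewrite /h.
  by do !case: ifP => _; rewrite ?oner_neq0// ?expf_neq0// expf_neq0.
pose x : 'rV[R]_L := \row_k 2 ^+ (a k + n.+1 * b k).
rewrite (_ : \matrix_(k, l) _ = (Vandermonde L x)^T); last first.
  apply/matrixP => k l; rewrite !mxE /loop_monomial l0 l1 l2 expr1n mul1r.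
  by rewrite -!exprM -exprD; congr (_ ^+ _); lia.
rewrite det_tr det_Vandermonde; apply/prodf_neq0 => k _; apply/prodf_neq0 => k' kk'.
rewrite subr_eq0 !mxE; apply: contraTneq kk' => /ieexprIn e.
by rewrite (inj_e k' k) ?ltnn//; apply: e; rewrite ?ltr0n ?pnatr_eq1.
Qed.

End generic.

Theorem theorem2 (R : realType) (d : measure_display) (Omega : measurableType d)
    (P : probability Omega R) (K L T : nat)
    (h : 'I_K -> 'I_K -> 'I_L -> {RV P >-> R}) :
  (4 <= K)%N -> (1 <= L)%N -> (1 <= T)%N ->
  has_density (joint_RV
    (fun ijl : 'I_K * 'I_K * 'I_L => h ijl.1.1 ijl.1.2 ijl.2)) ->
  {ae P, forall w,
    DoF (fun i j => channel_mx T (fun l => h i j l w))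
      <= K%:R / 2 * (1 - 1 / (20 * Num.sqrt L%:R))}.
Proof.
move=> K4 L1 T1 dens.
have [n Ln nL] := exists_binomial_bracket L1.
have [a [b [abn inj_e]]] := exists_exponents Ln.
pose u m (lt_m : (m < 4)%N) : 'I_K := Ordinal (leq_trans lt_m K4).
pose i0 := u 0%N isT; pose i1 := u 1%N isT.
pose i2 := u 2%N isT; pose i3 := u 3%N isT.
have uniq_i : uniq [:: i0; i1; i2; i3] by [].
have [t0 gt0] := genericity_neq0 R uniq_i inj_e.
have pg := polyfun_genericity R i0 i1 i2 i3 n a b.
(* The exceptional event depends on the channel alone, so beyond this point the strategy may depend
   on [w]. *)
apply: filterS (has_density_ae dens pg gt0) => w.
rewrite (_ : channel_of _ = fun i j l => h i j l w); last first.
  apply/funext => i; apply/funext => j; apply/funext => l.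
  by rewrite /channel_of tnth_mktuple enum_rankK.
rewrite mulf_eq0 negb_or => /andP[/prodf_neq0 h0 det0].
have h_neq0 i j l : h i j l w != 0 by exact: (h0 (i, j, l)).
have [[D [V strat] <-] _] := DoF_max (fun i j => channel_mx T (fun l => h i j l w)).
have bound := alignment_bound uniq_i h_neq0 abn det0 strat.
have LT0 : (0 < L * T)%N by rewrite muln_gt0 L1.
rewrite natrM [(T * L)%N]mulnC -!mulrA ler_wpM2l// -[2^-1]div1r.
exact: rate_of_bound L1 LT0 nL bound.
Qed.
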